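(* Let $a,b$ be positive integers, let $\{F_n(q)\}_{n\geq 0}$ be the $q$-biperiodic Fibonacci sequence and, for $s\geq 0$, let $\{F^{(s)}_n(q)\}_{n\geq 0}$ be the shifted $q$-biperiodic Fibonacci sequence. For all integers $n,m\geq 0$, $$F_{n+m+1}(q)=F_{m+1}(q)F_{n+1}^{(m)}(q) + q^mF_{m}(q)F_{n}^{(m+1)}(q).$$
   Context: Fix positive integers $a,b$; $q$ is an indeterminate. For an integer $n$, $\xi(n)=n-2\lfloor n/2\rfloor$ (so $\xi(n)=0$ if $n$ is even and $1$ if $n$ is odd). The $q$-biperiodic Fibonacci sequence is defined by $F_0(q)=0$, $F_1(q)=1$ and, for $n\geq 2$, $F_n(q)=aF_{n-1}(q)+q^{n-2}F_{n-2}(q)$ if $n$ is even, $F_n(q)=bF_{n-1}(q)+q^{n-2}F_{n-2}(q)$ if $n$ is odd. For an integer $s\geq 0$, the shifted $q$-biperiodic Fibonacci sequence is defined by $F^{(s)}_0(q)=0$, $F^{(s)}_1(q)=1$ and, for $n\geq 2$, $$F^{(s)}_{n}(q)=\begin{cases} a^{\xi(s+1)}b^{1-\xi(s+1)}F^{(s)}_{n-1}(q) + q^{n-2+s}F^{(s)}_{n-2}(q), & n \text{ even},\\ a^{1-\xi(s+1)}b^{\xi(s+1)}F^{(s)}_{n-1}(q) + q^{n-2+s}F^{(s)}_{n-2}(q), & n\text{ odd}.\end{cases}$$ *)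

(* Defs.v *)
From mathcomp Require Import all_boot all_order all_algebra.

Set Implicit Arguments.
Unset Strict Implicit.
Unset Printing Implicit Defensive.

Import GRing.Theory.
Local Open Scope ring_scope.

(* The indeterminate q is 'X in {poly int}. *)

Definition xi (n : nat) : nat := (n - 2 * (n %/ 2))%N.

(* In the branch n = k.+2 the exponent n - 2 of q is k. *)
Fixpoint qbifib (a b n : nat) : {poly int} :=
  match n with
  | 0 => 0
  | 1 => 1
  | (k.+1 as n1).+1 =>
      (if odd n then b else a)%:R * qbifib a b n1 + 'X^k * qbifib a b k
  end.

Fixpoint qbifib_shift (a b s n : nat) : {poly int} :=
  match n with
  | 0 => 0
  | 1 => 1
  | (k.+1 as n1).+1 =>
      (if odd n then a ^ (1 - xi s.+1) * b ^ xi s.+1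
       else a ^ xi s.+1 * b ^ (1 - xi s.+1))%N%:R * qbifib_shift a b s n1
      + 'X^(k + s) * qbifib_shift a b s k
  end.

(* Main.v *)
Require Import Defs.
From mathcomp Require Import all_boot all_order all_algebra ring.

Set Implicit Arguments.
Unset Strict Implicit.
Unset Printing Implicit Defensive.

Import GRing.Theory.
Local Open Scope ring_scope.

(* With m fixed, both sides satisfy the same three-term recurrence in n: the
   coefficient of the s-shifted sequence at index n depends only on the parity
   of n + s, and its power of q only on n + s. *)

Lemma xi_odd (n : nat) : xi n = odd n.
Proof. by rewrite /xi mulnC -modn2 {1}(divn_eq n 2) addKn. Qed.

(** Indexed two below the term it yields: the parity is unchanged and the index equals the exponent
    of [q]. *)
Definition qbifib_coef (a b n : nat) : {poly int} := (if odd n then b else a)%:R.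

Lemma qbifibSS (a b n : nat) :
  qbifib a b n.+2 = qbifib_coef a b n * qbifib a b n.+1 + 'X^n * qbifib a b n.
Proof. by rewrite /qbifib_coef -[odd n]negbK. Qed.

(** An odd [s] makes [xi s.+1] zero, which swaps [a] and [b]; an even [s] keeps them. *)
Lemma qbifib_shiftSS (a b s n : nat) :
  qbifib_shift a b s n.+2 =
    qbifib_coef a b (n + s) * qbifib_shift a b s n.+1
    + 'X^(n + s) * qbifib_shift a b s n.
Proof.
rewrite /= xi_odd /qbifib_coef oddD negbK /=.
by case: (odd n); case: (odd s); rewrite ?expn0 ?expn1 ?mul1n ?muln1.
Qed.

Theorem theorem15 (a b : nat) (ha : (0 < a)%N) (hb : (0 < b)%N) (n m : nat) :
  qbifib a b (n + m + 1) =
    qbifib a b (m + 1) * qbifib_shift a b m (n + 1)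
    + 'X^m * qbifib a b m * qbifib_shift a b (m + 1) n.
Proof.
rewrite !addn1.
elim/ltn_ind: n => [[|[|n]]] IH.
- by rewrite /= mulr1 mulr0 addr0.
(* This case is the recurrence for index [m.+2] itself. *)
- rewrite add1n qbifibSS qbifib_shiftSS add0n [qbifib_shift a b m 1]/=.
  by rewrite [qbifib_shift a b m 0]/= [qbifib_shift a b m.+1 1]/=; ring.
- have IH0 := IH n (leqnSn _); have IH1 := IH n.+1 (leqnn _).
  rewrite !addSn in IH1 *.
  (* The shifts [m] at index [n.+3] and [m.+1] at index [n.+2] share with the left side the
     coefficient and power at [(n + m).+1]. *)
  rewrite qbifibSS IH1 IH0 !qbifib_shiftSS addSn addnS; ring.
Qed.
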